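(* Let $\mathcal{I}_i$ be an interval with endpoints $\dot r_{i-1}$ and $\dot r_i$, where $0<\dot r_{i-1}<\dot r_i$, let $D(\mathcal{I}_i)=\dot r_i-\dot r_{i-1}$, and let $r$ be (conditionally on $r\in\mathcal{I}_i$) uniformly distributed on $\mathcal{I}_i$. Then the optimal solution of the problem $$\min_{\hat r_i\in\mathcal{I}_i}\ \mathbb{E}_r\!\left[\left|\frac1r-\frac1{\hat r_i}\right|\ \Big|\ r\in\mathcal{I}_i\right]$$ is $$\hat r_i^*=\frac12\left(\dot r_{i-1}+\dot r_i\right),$$ and the corresponding optimal value is $$\mathbb{E}_r\!\left[\left|\frac1r-\frac1{\hat r_i^*}\right|\ \Big|\ r\in\mathcal{I}_i\right]=\frac{2}{D(\mathcal{I}_i)}\log\frac{\xi_i+1/\xi_i}{2},\qquad \text{where } \xi_i=\sqrt{\frac{\dot r_i}{\dot r_{i-1}}}.$$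
   Context: Here $\log$ is the natural logarithm. The variable $r$ (a user's distance) is uniformly distributed on an interval $[r_{\min},r_{\max}]$ with $0<r_{\min}<r_{\max}$, and $\mathcal{I}_i\subseteq[r_{\min},r_{\max}]$ is one cell of a partition of this interval into intervals, so that conditionally on $r\in\mathcal{I}_i$ the variable $r$ is uniform on $\mathcal{I}_i$. *)

(* Defs.v *)
From HB Require Import structures.
From mathcomp Require Import all_boot all_order all_algebra.
From mathcomp Require Import all_classical all_reals all_analysis.
Set Implicit Arguments.
Unset Strict Implicit.
Unset Printing Implicit Defensive.
Import Order.TTheory GRing.Theory Num.Theory.
Import numFieldNormedType.Exports.
Local Open Scope classical_set_scope.
Local Open Scope ring_scope.
Local Open Scope ereal_scope.

Section conditioning.
Context (d : measure_display) (T : measurableType d) (R : realType).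
Variable P : probability T R.

(* Elementary conditioning on an event: only meaningful when [0 < P B]. *)
Definition cond_prob (A B : set T) : \bar R := P (A `&` B) / P B.

Definition cond_expectation (X : T -> R) (B : set T) : \bar R :=
  'E_P[X \* \1_B] / P B.

Definition cond_uniform (X : T -> R) (B : set T) (a b : R) (ab : (a < b)%R) :=
  0 < P B /\
  forall A : set R, measurable A ->
    cond_prob (X @^-1` A) B = uniform_prob ab A.

End conditioning.

Definition minimizers (R : realType) (S : set R) (f : R -> \bar R) : set R :=
  [set x | S x /\ forall y, S y -> f x <= f y].

(* The booleans select closed or open ends: a set [itv_between bl br a b] is
   any of the four intervals with endpoints a and b. *)
Definition itv_between (R : realType) (bl br : bool) (a b : R) : set R :=
  [set` Interval (BSide bl a) (BSide br b)].

Lemma uniform_probE (R : realType) (a b : R) (ab : (a < b)%R) (A : set R) :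
  measurable A ->
  uniform_prob ab A = ((b - a)^-1)%:E * lebesgue_measure (A `&` `[a, b]).
Proof.
move=> mA; rewrite /uniform_prob integral_uniform_pdf.
rewrite (eq_integral (fun=> (b - a)^-1%:E)); last first.
  by move=> x; rewrite inE/= => -[_]; rewrite in_itv/= /uniform_pdf => ->.
by rewrite integral_cst//; exact: measurableI.
Qed.

Lemma lebesgue_itv_between (R : realType) (bl br : bool) (a b : R) (A : set R) :
  measurable A ->
  lebesgue_measure (A `&` itv_between bl br a b) =
  lebesgue_measure (A `&` `[a, b]).
Proof.
move=> mA.
have cov : A `&` `[a, b] `<=` (A `&` itv_between bl br a b) `|` ([set a] `|` [set b]).
  move=> x [Ax]; rewrite /itv_between /= in_itv/= => /andP[ax xb].
  have [->|xa] := eqVneq x a; first by right; left.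
  have [->|xb'] := eqVneq x b; first by right; right.
  left; split => //=; rewrite /itv_between.
  have ax' : (a < x)%R by rewrite lt_neqAle eq_sym xa.
  have bx' : (x < b)%R by rewrite lt_neqAle xb'.
  by case: bl; case: br; rewrite /= in_itv/= ?ax ?ax' ?xb ?bx'.
have sub : itv_between bl br a b `<=` `[a, b].
  move=> x {cov}; rewrite /itv_between; case: bl; case: br => /=;
    by rewrite !in_itv/= => /andP[xa xb]; apply/andP; split => //; exact: ltW.
have mI : measurable (itv_between bl br a b).
  exact: measurable_itv.
apply/eqP; rewrite eq_le; apply/andP; split.
  apply: le_measure; rewrite ?inE; [exact: measurableI|exact: measurableI|].
  exact: setIS.
have m1 : measurable ([set a] `|` [set b]).
  exact: measurableU.
apply: (@le_trans _ _ (lebesgue_measure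
    ((A `&` itv_between bl br a b) `|` ([set a] `|` [set b])))).
  apply: le_measure; rewrite ?inE //; first exact: measurableI.
  by apply: measurableU => //; exact: measurableI.
rewrite measureU0//; first exact: measurableI.
rewrite measureU0//; exact: lebesgue_measure_set1.
Qed.

(* A variable that is uniform on an interval is conditionally uniform on each
   nondegenerate subinterval. *)
Lemma uniform_cond_uniform (d : measure_display) (T : measurableType d)
    (R : realType) (P : probability T R) (r : {RV P >-> R})
    (rmin rmax : R) (rmin_max : (rmin < rmax)%R)
    (bl br : bool) (a b : R) (ab : (a < b)%R) :
  (forall A, measurable A -> distribution P r A = uniform_prob rmin_max A) ->
  itv_between bl br a b `<=` `[rmin, rmax] ->
  cond_uniform P r (r @^-1` itv_between bl br a b) ab.
Proof.
move=> rU sub.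
have mI : measurable (itv_between bl br a b) by exact: measurable_itv.
have c0 : (0 < (rmax - rmin)^-1)%R by rewrite invr_gt0 subr_gt0.
have d0 : (0 < b - a)%R by rewrite subr_gt0.
have PE A : measurable A -> P (r @^-1` A `&` r @^-1` itv_between bl br a b) =
    ((rmax - rmin)^-1)%:E * lebesgue_measure (A `&` `[a, b]).
  move=> mA; rewrite -preimage_setI.
  have mAI : measurable (A `&` itv_between bl br a b) by exact: measurableI.
  transitivity (distribution P r (A `&` itv_between bl br a b)) => //.
  rewrite rU // uniform_probE// -setIA (setIidl sub).
  by rewrite lebesgue_itv_between.
have PI : P (r @^-1` itv_between bl br a b) = ((rmax - rmin)^-1 * (b - a))%:E.
  rewrite -[X in P X]setTI -(preimage_setT r) PE// setTI.
  by rewrite lebesgue_measure_itv/= lte_fin ab -EFinD -EFinM.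
split; first by rewrite PI lte_fin mulr_gt0.
move=> A mA; rewrite /cond_prob PE// PI uniform_probE//.
rewrite inver gt_eqF ?mulr_gt0// muleAC -EFinM; congr (_%:E * _).
by rewrite invfM mulrA mulfV ?mul1r// gt_eqF.
Qed.

(* Main.v *)
(* Given [r \in I], the law of [r] is uniform on [a, b], so the objective at h is
   (b - a)^-1 times the Lebesgue integral of |1/x - 1/h| over [a, b], namely
   (b - a)^-1 (2 ln h - ln a - ln b + (a + b)/h - 2) once the integral is split
   at h. With m = (a + b)/2, its excess over the value at m is
   2 (b - a)^-1 (t - 1 - ln t) for t = m/h, positive unless t = 1. *)
Require Import Defs.
From mathcomp Require Import all_boot all_order all_algebra.
From mathcomp Require Import all_classical all_reals all_analysis.
From mathcomp Require Import measurable_realfun.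
From mathcomp Require Import ring lra.
Set Implicit Arguments.
Unset Strict Implicit.
Unset Printing Implicit Defensive.
Import Order.TTheory GRing.Theory Num.Theory.
Import numFieldNormedType.Exports.
Local Open Scope classical_set_scope.
Local Open Scope ring_scope.

(** Inversion is continuous on the open complement of 0, and on the single point 0 measurability is
    automatic. *)
Lemma measurable_invr (R : realType) :
  measurable_fun [set: R] (@GRing.inv R : R -> R).
Proof.
rewrite -(setUv [set (0 : R)]); apply/measurable_funU => //; first exact: measurableC.
split; first exact: measurable_fun_set1.
apply: open_continuous_measurable_fun.
  exact/closed_openC/closed_eq.
by move=> x /[!inE] /eqP; exact: inv_continuous.
Qed.

Section conditional_law.
Context (d : measure_display) (T : measurableType d) (R : realType).
Variables (P : probability T R) (B : set T) (mB : measurable B).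

Lemma integral_mrestr (f : T -> \bar R) :
  measurable_fun setT f -> (forall x, 0 <= f x)%E ->
  (\int[mrestr P mB]_x f x = \int[P]_(x in B) f x)%E.
Proof.
move=> mf f0.
rewrite (@ge0_negligible_integral _ _ _ _ _ (~` B))//; last 2 first.
- exact: measurableC.
- by rewrite /= /mrestr setICl measure0.
rewrite setTD setCK; apply: eq_measure_integral => A mA AB.
by rewrite /= /mrestr setIidl.
Qed.

(** Change of variables along [r]. As [f] is nonnegative, no integrability has to be checked. *)
Lemma cond_expectation_uniform (r : {RV P >-> R}) (a b : R) (ab : a < b)
    (f : R -> R) :
  cond_uniform P r B ab -> measurable_fun setT f -> (forall x, 0 <= f x) ->
  cond_expectation P (f \o r) B =
  (((b - a)^-1)%:E * \int[lebesgue_measure]_(x in `[a, b]) (f x)%:E)%E.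
Proof.
move=> [PB0 rU] mf f0.
have mEf : measurable_fun setT (EFin \o f) by exact/measurable_EFinP.
have Ef0 x : (0 <= (f x)%:E)%E by rewrite lee_fin.
have PBfin : P B \is a fin_num by exact: fin_num_measure.
have k0 : 0 <= fine (P B) by exact: fine_ge0.
rewrite -(integral_uniform ab)// /cond_expectation unlock.
transitivity ((\int[P]_(x in B) (f (r x))%:E) / P B)%E.
  congr (_ / _)%E; rewrite [RHS]integral_mkcond; apply: eq_integral => x _.
  by rewrite epatch_indic /= EFinM.
rewrite -integral_mrestr//; last first.
  exact: (measurableT_comp mEf).
(* The uniform law lives on [measurableTypeR R], a different instance from the
   codomain of [r]. *)
pose s : T -> measurableTypeR R := r.
have ms : measurable_fun setT s by exact: (@measurable_funPT _ _ _ _ r).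
rewrite -[X in integral _ X _](preimage_setT s).
rewrite -(@ge0_integral_pushforward _ _ _ (measurableTypeR R) _ s ms
  (mrestr P mB) _ (EFin \o f))//; last by move=> x _; exact: Ef0.
(* Conditional uniformity multiplied through by [P B]: the image under [r] of the restricted measure
   is [P B] times the uniform law, and this factor cancels the division by [P B]. *)
rewrite (@eq_measure_integral _ _ _ _ (mscale (NngNum k0) (uniform_prob ab))).
  rewrite ge0_integral_mscale//= fineK// muleAC divee ?mul1e// gt_eqF//.
move=> A mA _; rewrite /= /pushforward /mrestr /mscale/= fineK// -rU//.
by rewrite /cond_prob muleCA divee ?mule1// gt_eqF.
Qed.

End conditional_law.

Section integral_reciprocal.
Variable R : realType.
Notation mu := (@lebesgue_measure R).

Lemma is_derive_affine_ln (c k x : R) : 0 < x ->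
  is_derive x 1 (fun x => c * x + k * ln x) (c + k / x).
Proof.
move=> x0; have dln := is_derive1_ln x0.
by apply: is_derive_eq; rewrite /GRing.scale/= mulr1.
Qed.

(** Fundamental theorem of calculus with antiderivative [c * x + k * ln x]. The case [u = v] is
    included because [h] may be an endpoint of [[a, b]] when the integral is split there. *)
Lemma integral_affine_inv (c k u v : R) : 0 < u -> u <= v ->
  (\int[mu]_(x in `[u, v]) (c + k / x)%:E =
   (c * (v - u) + k * (ln v - ln u))%:E)%E.
Proof.
move=> u0; rewrite le_eqVlt => /predU1P[<-|uv].
  by rewrite set_itv1 integral_set1 !subrr !mulr0 addr0.
have pos x : u <= x -> 0 < x by exact: lt_le_trans.
have dF x : u <= x -> derivable (fun x => c * x + k * ln x) x 1.
  by move=> /pos x0; have [] := is_derive_affine_ln c k x0.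
have cF x : u <= x -> {for x, continuous (fun x => c * x + k * ln x)}.
  by move=> /dF /derivable1_diffP /differentiable_continuous.
rewrite (@continuous_FTC2 _ _ (fun x => c * x + k * ln x) _ _ uv).
- by rewrite -EFinD; congr _%:E; ring.
- apply: continuous_in_subspaceT => x; rewrite inE/= in_itv/= => /andP[/pos x0 _].
  apply: cvgD; first exact: cvg_cst.
  apply: cvgM; first exact: cvg_cst.
  by apply: inv_continuous; rewrite gt_eqF.
- split=> [x /[!in_itv]/= /andP[/ltW ux _]||].
  + exact: dF.
  + by apply: cvg_at_right_filter; exact: cF.
  + by apply: cvg_at_left_filter; apply: cF; exact: ltW.
- move=> x /[!in_itv]/= /andP[/ltW/pos x0 _].
  by rewrite derive1E; have [_ ->] := is_derive_affine_ln c k x0.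
Qed.

Lemma measurable_dist_inv (h : R) :
  measurable_fun setT (fun x : R => `|1 / x - 1 / h|).
Proof.
apply: measurableT_comp => //; apply: measurable_funB => //.
by under eq_fun do rewrite div1r; exact: measurable_invr.
Qed.

Lemma integral_dist_inv (a b h : R) : 0 < a -> a <= h -> h <= b ->
  (\int[mu]_(x in `[a, b]) `|1 / x - 1 / h|%:E =
   (ln h *+ 2 - ln a - ln b + (a + b) / h - 2)%:E)%E.
Proof.
move=> a0 ah hb; have h0 : 0 < h by exact: lt_le_trans ah.
have mf D : measurable_fun D (fun x : R => `|1 / x - 1 / h|%:E).
  by apply/measurable_funTS/measurable_EFinP; exact: measurable_dist_inv.
rewrite (@itv_bndbnd_setU _ _ (BLeft a) (BRight h) (BRight b)) ?bnd_simp//.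
rewrite ge0_integral_setU//; [|exact: mf|]; last first.
  rewrite disj_set2E; apply/eqP/seteqP; split => // x [/=].
  by rewrite !in_itv/= => /andP[_ xh] /andP[/(le_lt_trans xh)]; rewrite ltxx.
(* The right-hand piece is []h, b]]; adding the null point [h] closes it. *)
rewrite integral_itv_obnd_cbnd//.
(* Since [1 / x] decreases, the absolute value opens with sign + left of [h] and - right of it. *)
transitivity (\int[mu]_(x in `[a, h]) (- h^-1 + 1 / x)%:E +
              \int[mu]_(x in `[h, b]) (h^-1 + -1 / x)%:E)%E.
  congr (_ + _)%E; apply: eq_integral => x; rewrite inE/= in_itv/= !div1r.
    move=> /andP[/(lt_le_trans a0) x0 xh]; congr _%:E.
    by rewrite ger0_norm ?subr_ge0 ?lef_pV2// addrC.
  move=> /andP[hx _]; have x0 := lt_le_trans h0 hx; congr _%:E.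
  by rewrite ler0_norm ?subr_le0 ?lef_pV2// opprB mulN1r.
rewrite !integral_affine_inv// -EFinD; congr _%:E.
by field; rewrite gt_eqF.
Qed.

End integral_reciprocal.

(** This is [1 + y < expR y] at [y = ln x], nonzero because [x != 1]. Strictness is what yields
    uniqueness of the minimizer. *)
Lemma ln_lt_sub1 (R : realType) (x : R) : 0 < x -> x != 1 -> ln x < x - 1.
Proof.
move=> x0 x1; have lnx0 : ln x != 0 by rewrite ln_eq0.
by rewrite ltrBrDl (lt_le_trans (expR_gt1Dx lnx0))// lnK.
Qed.

(** Both sides are the logarithm of [(a + b) ^+ 2 / (4 * a * b)], as [xi ^+ 2 = b / a]. *)
Lemma ln_half_sqrtD (R : realType) (a b : R) : 0 < a -> 0 < b ->
  let xi := Num.sqrt (b / a) in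
  2 * ln ((xi + 1 / xi) / 2) = ln (1 / 2 * (a + b)) *+ 2 - ln a - ln b.
Proof.
move=> a0 b0 xi.
have ba0 : 0 < b / a by rewrite divr_gt0.
have xi0 : 0 < xi by rewrite sqrtr_gt0.
have xi2 : xi ^+ 2 = b / a by rewrite sqr_sqrtr// ltW.
have m0 : 0 < 1 / 2 * (a + b) by rewrite mulr_gt0// addr_gt0.
have z0 : 0 < (xi + 1 / xi) / 2 by rewrite divr_gt0// addr_gt0// divr_gt0.
rewrite mulr_natl -!lnXn// -!ln_div ?posrE ?divr_gt0 ?exprn_gt0//; congr ln.
transitivity ((xi ^+ 2 + 1) ^+ 2 / (xi ^+ 2 * 4)).
  by field; rewrite gt_eqF.
by rewrite xi2; field; rewrite !gt_eqF.
Qed.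

Theorem proposition1 (d : measure_display) (T : measurableType d)
    (R : realType) (P : probability T R) (r : {RV P >-> R})
    (a b : R) (bl br : bool) (a_gt0 : 0 < a) (ab : a < b) :
  let I := itv_between bl br a b in
  cond_uniform P r (r @^-1` I) ab ->
  let D := b - a in
  let xi := Num.sqrt (b / a) in
  let objective (rhat : R) : \bar R :=
    cond_expectation P (fun w => `| 1 / r w - 1 / rhat |) (r @^-1` I) in
  let rstar := 1 / 2 * (a + b) in
  minimizers I objective = [set rstar] /\
  objective rstar = (2 / D * ln ((xi + 1 / xi) / 2))%:E.
Proof.
move=> I rU D xi objective m.
have b0 : 0 < b := lt_trans a_gt0 ab.
have D0 : 0 < D by rewrite subr_gt0.
have m0 : 0 < m by rewrite mulr_gt0// addr_gt0.
have am : a < m by rewrite /m; lra.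
have mb : m < b by rewrite /m; lra.
have abm : a + b = 2 * m by rewrite /m; field.
have Iab x : I x -> a <= x <= b.
  rewrite /I /itv_between; case: (bl); case: (br); rewrite /= in_itv/= => /andP[ax xb];
    by apply/andP; split => //; exact: ltW.
have mI : measurable (r @^-1` I).
  by rewrite -[_ @^-1` _]setTI; apply: measurable_funPT => //; exact: measurable_itv.
have objE h : a <= h <= b -> objective h =
    (D^-1 * (ln h *+ 2 - ln a - ln b + (a + b) / h - 2))%:E.
  move=> /andP[ah hb].
  rewrite /objective.
  rewrite (cond_expectation_uniform mI rU (f := fun x => `|1 / x - 1 / h|))//.
    by rewrite integral_dist_inv// -EFinM.
  exact: measurable_dist_inv.
(* The midpoint is strictly interior, so it is feasible whichever ends are open. *)
have Im : I m.
  by rewrite /I /itv_between; case: (bl); case: (br); rewrite /= in_itv/= ?am ?mb ?ltW.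
(* At the midpoint [(a + b) / m = 2], which cancels the constant term. *)
have objm : objective m = (D^-1 * (ln m *+ 2 - ln a - ln b))%:E.
  rewrite objE ?ltW ?am//; congr (_ * _)%:E; rewrite abm.
  by field; rewrite gt_eqF.
(* This strict inequality gives both inclusions: a feasible [h != m] is not minimal, and [m] is
   minimal. *)
have m_lt h : I h -> h != m -> (objective m < objective h)%E.
  move=> /Iab hab hm; have /andP[ah _] := hab; have h0 := lt_le_trans a_gt0 ah.
  rewrite objm objE// lte_fin ltr_pM2l ?invr_gt0//.
  have mh1 : m / h != 1.
    by apply: contraNneq hm => e; rewrite -[m](divfK (lt0r_neq0 h0)) e mul1r.
  have := ln_lt_sub1 (divr_gt0 m0 h0) mh1.
  by rewrite ln_div ?posrE// abm -[2 * m / h]mulrA !(mulr2n (ln _)); lra.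
split; last first.
  by rewrite objm mulrAC ln_half_sqrtD// mulrC.
apply/seteqP; split => [h [Ih hmin]|_ ->] /=.
  by apply/eqP/negPn/negP => /(m_lt _ Ih); rewrite ltNge hmin.
by split => // h Ih; have [->//|/(m_lt _ Ih)/ltW] := eqVneq h m.
Qed.
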